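(* For every constant $L$ there is a polynomial-time algorithm and a function $\varepsilon:\mathbb{N}\to\mathbb{R}_{\ge 0}$ with $\varepsilon(d)\to 0$ as $d\to\infty$ such that, given any finite connected graph $G$ of diameter $d$ and path-length at most $L$, the algorithm outputs a burning schedule that burns all vertices of $G$ within at most $(1+\varepsilon(d))\, bn(G)$ rounds. (That is, for graphs of bounded path-length there is an algorithm with approximation factor $1+o(1)$.)
   Context: Graphs are finite, simple, undirected and unweighted; $d(u,v)$ denotes the shortest-path distance. Burning process: it takes place in synchronous rounds $1,2,\dots$. In each round $i$, every vertex having a neighbour that was burned in an earlier round becomes burned, and additionally one chosen vertex $a_i$ (the activator of round $i$) becomes burned; burned vertices stay burned. A burning schedule $\langle a_1,\dots,a_m\rangle$ burns $G$ in $m$ rounds if all vertices are burned by the end of round $m$, equivalently every vertex $v$ satisfies $d(v,a_i)\le m-i$ for some $i\in\{1,\dots,m\}$. The burning number $bn(G)$ is the minimum $m$ for which a burning schedule burning $G$ in $m$ rounds exists. A path decomposition of $G$ is a path whose nodes are finitely many bags, each bag being a subset of the vertices of $G$, such that every edge $\{v,w\}$ of $G$ has both endpoints in some common bag, and for every vertex $v$ of $G$ the bags containing $v$ form a (nonempty) connected subpath. The length of a decomposition is the maximum of $d(x,y)$ (distance in $G$) over all pairs $x,y$ lying in a common bag; the path-length of $G$ is the minimum length over all its path decompositions. *)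

(* Defs.v *)
From mathcomp Require Import all_boot boolp.

Set Implicit Arguments.
Unset Strict Implicit.
Unset Printing Implicit Defensive.

Definition sgraph (T : finType) (e : rel T) : Prop :=
  symmetric e /\ irreflexive e.

(* The graph with no vertices does not count as connected. *)
Definition connected_graph (T : finType) (e : rel T) : Prop :=
  0 < #|T| /\ forall x y : T, connect e x y.

Definition walk (T : finType) (e : rel T) (k : nat) (x y : T) : bool :=
  [exists p : k.-tuple T, path e x p && (last x p == y)].

(* Two vertices joined by a walk are joined by one of length < #|T|; vertices
   in different components get the dummy value #|T|. *)
Definition dist (T : finType) (e : rel T) (x y : T) : nat :=
  find (fun k => walk e k x y) (iota 0 #|T|).

Definition diameter (T : finType) (e : rel T) : nat :=
  \max_(x : T) \max_(y : T) dist e x y.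

(* One round: [B] is the set of vertices burned in earlier rounds, [a] is the
   activator of the round. *)
Definition burn_round (T : finType) (e : rel T) (B : {set T}) (a : T) :
    {set T} :=
  a |: (B :|: [set v | [exists u in B, e u v]]).

Definition burned (T : finType) (e : rel T) (s : seq T) : {set T} :=
  foldl (burn_round e) set0 s.

Definition burns (T : finType) (e : rel T) (s : seq T) : bool :=
  burned e s == [set: T].

Lemma burnable (T : finType) (e : rel T) :
  exists m, [exists s : m.-tuple T, burns e s].
Proof.
exists (size (enum T)); apply/existsP; exists (in_tuple (enum T)).
rewrite /burns /burned eqEsubset subsetT /=; apply/subsetP => x _.
have sub s (B : {set T}) : {subset B <= foldl (burn_round e) B s}.
  elim: s B => [|a s IHs] B y yB //=; apply: IHs.
  by rewrite /burn_round !inE yB orbT.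
have: x \in enum T by rewrite mem_enum.
elim: (enum T) set0 => //= a s IHs B; rewrite inE => /predU1P[-> | /IHs//].
by apply: sub; rewrite /burn_round !inE eqxx.
Qed.

Definition burning_number (T : finType) (e : rel T) : nat :=
  ex_minn (burnable e).

(* A path of bags is the sequence of its bags from one end to the other; the
   last clause says that the bags containing [v] are consecutive. *)
Definition path_decomposition (T : finType) (e : rel T) (B : seq {set T}) :
    Prop :=
  [/\ forall v, exists2 X, X \in B & v \in X,
      forall v w, e v w -> exists X, [/\ X \in B, v \in X & w \in X]
    & forall v i j k, i <= j <= k ->
        v \in nth set0 B i -> v \in nth set0 B k -> v \in nth set0 B j].

Definition decomposition_length (T : finType) (e : rel T) (B : seq {set T}) :
    nat :=
  \max_(X <- B) \max_(x in X) \max_(y in X) dist e x y.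

Lemma decomposable (T : finType) (e : rel T) :
  exists l, `[< exists2 B, path_decomposition e B &
                  decomposition_length e B = l >].
Proof.
exists (decomposition_length e [:: [set: T]]); apply/asboolP.
exists [:: [set: T]] => //; split.
- by move=> v; exists [set: T]; rewrite ?inE.
- by move=> v w _; exists [set: T]; rewrite !inE.
- move=> v i j [|k] /andP[ij jk]; last by rewrite /= nth_nil inE.
  by move: jk; rewrite leqn0 => /eqP->; rewrite /= inE.
Qed.

Definition path_length (T : finType) (e : rel T) : nat :=
  ex_minn (decomposable e).

(* Algorithms are programs for a random-access machine with structured control
   flow.  A program uses finitely many registers and finitely many unbounded
   arrays, all holding natural numbers; [mem st a k] is cell [k] of array [a].
   The arithmetic is addition and truncated subtraction.  There is deliberately
   no multiplication: the maximal bit length of the stored numbers then grows by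
   at most one per unit of time, so polynomial time for the uniform cost measure
   below is polynomial time for Turing machines. *)
Inductive expr : Type :=
  | ECst of nat
  | EReg of nat
  | EGet of nat & expr
  | EAdd of expr & expr
  | ESub of expr & expr.

Inductive cmd : Type :=
  | CSkip
  | CSet of nat & expr
  | CPut of nat & expr & expr
  | CSeq of cmd & cmd
  | CIf of expr & cmd & cmd
  | CWhile of expr & cmd.

Record state : Type := State {
  regs : nat -> nat;
  mem : nat -> nat -> nat }.

Definition set_reg (st : state) (x v : nat) : state :=
  State (fun y => if y == x then v else regs st y) (mem st).

Definition set_mem (st : state) (a k v : nat) : state :=
  State (regs st)
        (fun b l => if (b == a) && (l == k) then v else mem st b l).

Fixpoint eval (st : state) (f : expr) : nat :=
  match f with
  | ECst c => c
  | EReg x => regs st x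
  | EGet a g => mem st a (eval st g)
  | EAdd g h => eval st g + eval st h
  | ESub g h => eval st g - eval st h
  end.

Fixpoint cost (f : expr) : nat :=
  match f with
  | ECst _ | EReg _ => 1
  | EGet _ g => (cost g).+1
  | EAdd g h | ESub g h => (cost g + cost h).+1
  end.

(* [exec c st t st']: started in [st], the command [c] halts in state [st']
   after time [t].  A test succeeds when its value is nonzero. *)
Inductive exec : cmd -> state -> nat -> state -> Prop :=
  | ExecSkip st : exec CSkip st 1 st
  | ExecSet x f st :
      exec (CSet x f) st (cost f).+1 (set_reg st x (eval st f))
  | ExecPut a f g st :
      exec (CPut a f g) st (cost f + cost g).+1
           (set_mem st a (eval st f) (eval st g))
  | ExecSeq c1 c2 st st1 st2 t1 t2 :
      exec c1 st t1 st1 -> exec c2 st1 t2 st2 ->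
      exec (CSeq c1 c2) st (t1 + t2).+1 st2
  | ExecIfTrue f c1 c2 st st' t :
      eval st f != 0 -> exec c1 st t st' ->
      exec (CIf f c1 c2) st (cost f + t).+1 st'
  | ExecIfFalse f c1 c2 st st' t :
      eval st f = 0 -> exec c2 st t st' ->
      exec (CIf f c1 c2) st (cost f + t).+1 st'
  | ExecWhileTrue f c st st1 st2 t1 t2 :
      eval st f != 0 -> exec c st t1 st1 -> exec (CWhile f c) st1 t2 st2 ->
      exec (CWhile f c) st (cost f + t1 + t2).+1 st2
  | ExecWhileFalse f c st :
      eval st f = 0 -> exec (CWhile f c) st (cost f).+1 st.

(* The input graph has vertices 0, ..., n-1: register 0 holds n, and array 0
   holds the adjacency matrix, row by row.  Everything else is 0. *)
Definition graph_input (n : nat) (e : rel 'I_n) : state :=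
  State (fun x => if x == 0 then n else 0)
        (fun a k => if a == 0 then
                      nat_of_bool [exists i : 'I_n, exists j : 'I_n,
                                     (k == i * n + j) && e i j]
                    else 0).

(* The output is in array 1, its length in register 0. *)
Definition outputs (P : cmd) (n : nat) (e : rel 'I_n) (s : seq 'I_n) : Prop :=
  exists t st, exec P (graph_input e) t st /\
    mkseq (mem st 1) (regs st 0) = [seq val v | v <- s].

(* The program must halt in time polynomial in the number of vertices on every
   graph, not only on the graphs for which its output is of interest. *)
Definition polynomial_time (P : cmd) : Prop :=
  exists c k : nat, forall (n : nat) (e : rel 'I_n), sgraph e ->
    exists t st, exec P (graph_input e) t st /\ t <= c * n ^ k + c.

(* Main.v *)
(* A ball of radius [r] meets at most [2 r + 1] of the distance levels of a
   vertex, so burning numbers satisfy [bn ^ 2 > d].  Conversely, let [u] be at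
   maximal distance from an arbitrary vertex [z].  In a path decomposition every
   bag separates the bags on its two sides, so beyond a bag containing [u], on
   the side away from [z], all vertices are within [2 L] of [u]; hence any two
   vertices at the same distance from [u] are at distance at most [4 L].
   Burning one vertex in the middle level of each interval [r^2, (r + 1)^2[ of
   levels, with radius [r + 4 L], burns everything and costs only [4 L] rounds
   more than the lower bound.  Two breadth-first searches yield this schedule;
   the decomposition is never computed. *)
Require Import Defs.
From mathcomp Require Import all_boot all_order all_algebra.
From mathcomp Require Import zify.
From mathcomp Require Import boolp reals topology normedtype sequences realfun.

Set Implicit Arguments.
Unset Strict Implicit.
Unset Printing Implicit Defensive.

(** * Walks and graph distance *)

Section Distance.
Variables (T : finType) (e : rel T).

Lemma walkP k x y :
  reflect (exists p, [/\ size p = k, path e x p & last x p = y])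
          (walk e k x y).
Proof.
apply: (iffP existsP) => [[p /andP[xp /eqP yp]]|[p [<- xp yp]]].
  by exists p; rewrite size_tuple.
by exists (in_tuple p); rewrite xp yp eqxx.
Qed.

Lemma walk0 x y : walk e 0 x y = (x == y).
Proof.
apply/walkP/eqP => [[p [/size0nil-> _ //]]|<-].
by exists [::].
Qed.

Lemma walk1 x y : e x y -> walk e 1 x y.
Proof. by move=> xy; apply/walkP; exists [:: y]; rewrite /= xy. Qed.

Lemma walkD j k x y z : walk e j x y -> walk e k y z -> walk e (j + k) x z.
Proof.
move=> /walkP[p [<- xp yp]] /walkP[q [<- yq zq]]; apply/walkP.
by exists (p ++ q); rewrite size_cat cat_path last_cat yp xp yq zq.
Qed.

Lemma walkS k x y : walk e k.+1 x y -> exists2 z, e x z & walk e k z y.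
Proof.
move=> /walkP[[|z p] [] // [<-] /= /andP[xz zp] yp].
by exists z => //; apply/walkP; exists p.
Qed.

Lemma walkDP j k x y :
  walk e (j + k) x y -> exists2 z, walk e j x z & walk e k z y.
Proof.
elim: j x => [|j IHj] x; first by exists x; rewrite ?walk0.
move=> /walkS[z xz /IHj[t zt ty]]; exists t => //.
exact: (walkD (walk1 xz)).
Qed.

Lemma walk_sym k : symmetric e -> forall x y, walk e k x y -> walk e k y x.
Proof.
move=> e_sym; elim: k => [|k IHk] x y.
  by rewrite !walk0 eq_sym.
move=> /walkS[z xz /IHk yz]; rewrite -addn1; apply: walkD yz _.
by apply: walk1; rewrite e_sym.
Qed.

Lemma dist_leq k x y : walk e k x y -> dist e x y <= k.
Proof.
move=> xy; have [nk|kn] := leqP #|T| k.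
  by apply: leq_trans nk; rewrite /dist -{2}(size_iota 0 #|T|) find_size.
rewrite leqNgt; apply/negP => /(before_find 0).
by rewrite nth_iota //= xy.
Qed.

Lemma dist_edge x y : e x y -> dist e x y <= 1.
Proof. by move=> /walk1/dist_leq. Qed.

Lemma distxx x : dist e x x = 0.
Proof. by apply/eqP; rewrite -leqn0 dist_leq ?walk0. Qed.

Hypothesis e_conn : connected_graph e.

(** A duplicate-free connecting path has fewer than [#|T|] edges, so the search in [dist] succeeds
    and its default value never occurs. *)
Lemma dist_ltn_walk x y : dist e x y < #|T| /\ walk e (dist e x y) x y.
Proof.
have /connectP[p xp yp] := e_conn.2 x y.
case/shortenP: xp yp => q xq uq _ yq.
have: has (fun k => walk e k x y) (iota 0 #|T|).
  apply/hasP; exists (size q); last by apply/walkP; exists q.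
  rewrite mem_iota /= add0n -ltnS.
  by have := max_card (mem (x :: q)); rewrite (card_uniqP uq).
rewrite -/(dist e x y) => xy; have := nth_find 0 xy.
by move: xy; rewrite has_find size_iota => lt_n; rewrite nth_iota.
Qed.

Lemma dist_ltn x y : dist e x y < #|T|.
Proof. by case: (dist_ltn_walk x y). Qed.

Lemma dist_walk x y : walk e (dist e x y) x y.
Proof. by case: (dist_ltn_walk x y). Qed.

Lemma dist_triangle y x z : dist e x z <= dist e x y + dist e y z.
Proof. exact: dist_leq (walkD (dist_walk x y) (dist_walk y z)). Qed.

Lemma dist_split k x y : k <= dist e x y ->
  exists2 z, dist e x z = k & dist e z y = dist e x y - k.
Proof.
move=> kxy; have := dist_walk x y; rewrite -{1}(subnKC kxy).
move=> /walkDP[z /dist_leq xz /dist_leq zy]; exists z;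
  have := dist_triangle z x y; lia.
Qed.

Lemma dist_last x y k : dist e x y = k.+1 -> exists2 z, dist e x z = k & e z y.
Proof.
move=> xy; case: (@dist_split k x y); first by rewrite xy.
move=> z xz zy; exists z => //; have := dist_walk z y.
by rewrite zy xy subSnn => /walkS[t zt]; rewrite walk0 => /eqP<-.
Qed.

Hypothesis e_sym : symmetric e.

Lemma dist_sym x y : dist e x y = dist e y x.
Proof.
by apply/eqP; rewrite eqn_leq !dist_leq // (walk_sym e_sym) // dist_walk.
Qed.

(** * Burned sets as unions of balls, and the lower bound *)

Lemma mem_burned s x : reflect
  (exists2 i, i < size s & dist e (nth x s i) x <= size s - i.+1)
  (x \in burned e s).
Proof.
elim/last_ind: s x => [|s a IHs] x.
  by rewrite /burned inE; constructor=> -[].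
rewrite /burned foldl_rcons -/(burned e s) /burn_round !inE size_rcons.
apply: (iffP idP) => [/predU1P[->|]|[i]].
- by exists (size s); rewrite // nth_rcons ltnn eqxx distxx.
- case/orP => [/IHs[i lti xi]|/existsP[u /andP[/IHs[i lti ui] ux]]].
    by exists i; rewrite ?nth_rcons ?lti; lia.
  exists i; first lia; rewrite nth_rcons lti (set_nth_default u) //.
  by have := dist_triangle u (nth u s i) x; have := dist_edge ux; lia.
rewrite ltnS leq_eqVlt nth_rcons => /predU1P[->|lti].
  rewrite ltnn eqxx subnn leqn0 => /eqP xa; apply/predU1P; left.
  by have := dist_walk a x; rewrite xa walk0 => /eqP.
rewrite lti => xi; apply/predU1P; right.
case d_xi: (dist e (nth x s i) x) => [|k].
  by apply/orP; left; apply/IHs; exists i => //; rewrite d_xi.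
(* The predecessor of [x] on a shortest walk is one step nearer to the activator, so it was burned
   before the last round. *)
have [u iu ux] := dist_last d_xi.
apply/orP; right; apply/existsP; exists u; rewrite ux andbT; apply/IHs.
exists i => //; rewrite (set_nth_default x) // iu; lia.
Qed.

Lemma burnsP s : reflect
  (forall x, exists2 i, i < size s & dist e (nth x s i) x <= size s - i.+1)
  (burns e s).
Proof.
rewrite /burns eqEsubset subsetT /=.
apply: (iffP subsetP) => [bs x|bs x _]; apply/mem_burned => //.
by apply: bs; rewrite inE.
Qed.

Lemma sum_interval N c r :
  \sum_(k < N) ((c <= k + r) && (k <= c + r)) <= r.*2.+1.
Proof.
(* Bounding by the length of the truncated interval makes induction on [N] possible. *)
suff: \sum_(k < N) ((c <= k + r) && (k <= c + r)) <=
      minn (c + r).+1 N - (c - r) by move=> /leq_trans; apply; lia.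
elim: N => [|N IHN]; first by rewrite big_ord0.
rewrite big_ord_recr /=; move: IHN.
set s := \sum_(_ < _) _; lia.
Qed.

(** Double counting of pairs of a level and an activator whose ball meets it; the radii are
    [0, ..., m - 1] in reverse, and the first [m] odd numbers add up to [m ^ 2]. *)
Lemma burns_dist s x y : burns e s -> dist e x y < size s ^ 2.
Proof.
move=> /burnsP bs; set m := size s; set d := dist e x y.
have: \sum_(k < d.+1) 1 <=
  \sum_(k < d.+1) \sum_(i < m) ((dist e x (nth x s i) <= k + (m - i.+1)) &&
     (k <= dist e x (nth x s i) + (m - i.+1))).
  apply: leq_sum => k _; have kd : k <= d by rewrite -ltnS.
  have [z xz _] := dist_split kd; have [i lti iz] := bs z.
  rewrite (bigD1 (Ordinal lti)) //= (set_nth_default z) // -/m in iz *.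
  have := dist_triangle z x (nth z s i).
  have := dist_triangle (nth z s i) x z.
  rewrite (dist_sym z) xz; lia.
rewrite sum1_card card_ord exchange_big /= => /leq_trans; apply.
apply: (@leq_trans (\sum_(i < m) (m - i.+1).*2.+1)).
  by apply: leq_sum => i _; apply: sum_interval.
have -> : \sum_(i < m) (m - i.+1).*2.+1 = \sum_(i < m) i.*2.+1.
  rewrite -(big_mkord xpredT (fun i => (m - i.+1).*2.+1)) big_nat_rev big_mkord.
  by apply: eq_bigr => i _; congr (_.*2.+1); have := ltn_ord i; lia.
elim: m => [|m IHm]; first by rewrite big_ord0.
by rewrite big_ord_recr /=; move: IHm; set t := \sum_(_ < _) _; nia.
Qed.

(** * Burning by distance levels *)

Definition max_level_diam K u :=
  forall x y, dist e u x = dist e u y -> dist e x y <= K.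

(* Radius [rho] serves levels [rho^2, ..., rho^2 + 2 rho]. *)
Lemma burns_levels K u r s :
    max_level_diam K u -> (forall x, dist e u x < r ^ 2) -> size s = r + K ->
    (forall rho x0, rho < r -> rho ^ 2 <= \max_x dist e u x ->
       dist e u (nth x0 s (r - rho.+1)) =
         minn (rho ^ 2 + rho) (\max_x dist e u x)) ->
  burns e s.
Proof.
move=> diamK rP sz sP; apply/burnsP => x; set M := \max_x _ in sP.
have xM : dist e u x <= M by apply: (leq_bigmax x).
have [rho rho_le rho_gt] : 
    exists2 rho, rho ^ 2 <= dist e u x & dist e u x < rho.+1 ^ 2.
  have rx := rP x; elim: r rx {sz sP rP} => // r IHr rx.
  by have [/IHr//|le_r] := ltnP (dist e u x) (r ^ 2); exists r.
have rho_r : rho < r by rewrite -ltn_sqr; apply: leq_ltn_trans (rP x).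
(* With [r + K] activators, this index leaves [rho + K] rounds: [rho] to change level and [K] to
   move within one. *)
exists (r - rho.+1); first by rewrite sz; lia.
set a := nth _ _ _; have a_lev : dist e u a = minn (rho ^ 2 + rho) M.
  by apply: sP; lia.
apply: (@leq_trans (rho + K)); last by rewrite sz; lia.
(* A shortest walk from [u] to the farther of [a] and [x] is cut at the level of the nearer one; the
   rest has length at most [rho], also when the level of [a] is capped at [M]. *)
have [le_a|le_x] := leqP (dist e u a) (dist e u x).
  have [z uz zx] := dist_split le_a.
  have := dist_triangle z a x; have /diamK := esym uz; nia.
have [z uz za] := dist_split (ltnW le_x).
have := dist_triangle z a x; have /diamK := uz; rewrite (dist_sym a z); nia.
Qed.

(** * Path decompositions and the diameter of levels *)

Section PathDecomposition.
Variables (B : seq {set T}) (L : nat).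
Hypothesis B_decomp : path_decomposition e B.
Hypothesis B_length : decomposition_length e B <= L.

Lemma dist_bag X x y : X \in B -> x \in X -> y \in X -> dist e x y <= L.
Proof.
move=> XB xX yX; apply: leq_trans B_length.
apply: (@leq_trans (\max_(x in X) \max_(y in X) dist e x y)).
  by apply: (@leq_trans (\max_(y in X) dist e x y));
    [apply: (leq_bigmax_cond y) | apply: (leq_bigmax_cond x)].
pose diam (X : {set T}) := \max_(x in X) \max_(y in X) dist e x y.
exact: (@leq_bigmax_seq _ B xpredT diam).
Qed.

Definition in_bag i x := x \in nth set0 B i.

Lemma in_bag_size i x : in_bag i x -> i < size B.
Proof.
by rewrite /in_bag; case: ltnP => // le_i; rewrite nth_default ?inE.
Qed.

Lemma dist_in_bag i x y : in_bag i x -> in_bag i y -> dist e x y <= L.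
Proof.
move=> xi; apply: dist_bag (xi); exact: mem_nth (in_bag_size xi).
Qed.

Lemma bag_exists x : exists i, in_bag i x.
Proof.
case: B_decomp => /(_ x)[X /(nthP set0)[i _ <-] xX] _ _.
by exists i.
Qed.

(** Symmetric in the two ends, so that no orientation of the decomposition has to be chosen. *)
Definition between j i k := (i <= j <= k) || (k <= j <= i).

Lemma in_bag_between j i k x : between j i k ->
  in_bag i x -> in_bag k x -> in_bag j x.
Proof.
case: B_decomp => _ _ convB /orP[] ijk xi xk; first exact: convB ijk xi xk.
exact: convB ijk xk xi.
Qed.

(** The first edge lies in some bag [m]. Either [j] is between [m] and [k], and the rest of the walk
    crosses bag [j]; or [j] is between [i] and [m], and [x] itself lies in bag [j]. *)
Lemma walk_cross l x y i j k : between j i k ->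
    in_bag i x -> in_bag k y -> walk e l x y ->
  exists z a b, [/\ in_bag j z, l = a + b, walk e a x z & walk e b z y].
Proof.
move=> ijk xi yk; elim: l x i xi ijk => [|l IHl] x i xi ijk.
  rewrite walk0 => /eqP xy; exists x, 0, 0; rewrite !walk0 xy eqxx; split=> //.
  by rewrite -xy; apply: in_bag_between ijk xi _; rewrite xy.
move=> xy; have /walkS[x' xx' x'y] := xy.
have [m xm x'm] : exists2 m, in_bag m x & in_bag m x'.
  case: B_decomp => _ /(_ _ _ xx')[X [/(nthP set0)[m _ <-] xX x'X]] _.
  by exists m.
have [mjk|ijm] : between j m k \/ between j i m.
  by move: ijk; rewrite /between; lia.
  have [z [a [b [zj -> x'z zy]]]] := IHl _ _ x'm mjk x'y.
  by exists z, a.+1, b; split=> //; apply: (walkD (walk1 xx') x'z).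
exists x, 0, l.+1; rewrite walk0 eqxx; split=> //.
exact: in_bag_between ijm xi xm.
Qed.

Lemma dist_cross x y i j k : between j i k -> in_bag i x -> in_bag k y ->
  exists2 z, in_bag j z & dist e x y = dist e x z + dist e z y.
Proof.
move=> ijk xi yk.
have [z [a [b [zj ab /dist_leq xz /dist_leq zy]]]] :=
  walk_cross ijk xi yk (dist_walk x y).
by exists z => //; have := dist_triangle z x y; lia.
Qed.

(** A shortest walk from [u] to [y] crosses the bag of [x] at some [z] within [L] of [x]; as [x] and
    [y] have equal level, at most [L] steps remain from [z] to [y]. *)
Lemma dist_same_side u x y i j k : between j i k -> in_bag i u -> in_bag j x ->
  in_bag k y -> dist e u x = dist e u y -> dist e x y <= L.*2.
Proof.
move=> ijk ui xj yk uxy.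
have [z zj uy] := dist_cross ijk ui yk.
have := dist_in_bag xj zj; have := dist_triangle z x y.
have := dist_triangle z u x; rewrite (dist_sym z x); lia.
Qed.

(** A shortest walk from [z] to [x] crosses the bag of [u] at some [t] within [L] of [u]; as [x] is
    no farther from [z] than [u], at most [L] steps remain from [t] to [x]. *)
Lemma dist_behind_farthest z u x i j k : between j i k ->
    in_bag i z -> in_bag j u -> in_bag k x -> dist e z x <= dist e z u ->
  dist e u x <= L.*2.
Proof.
move=> ijk zi uj xk le_zu.
have [t tj zx] := dist_cross ijk zi xk.
have := dist_in_bag uj tj; have := dist_triangle t u x.
have := dist_triangle t z u; rewrite (dist_sym t u); lia.
Qed.

Lemma level_diam_farthest_bags z u :
  (forall x, dist e z x <= dist e z u) -> max_level_diam (4 * L) u.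
Proof.
move=> farP x y uxy.
have [[i zi] [j uj]] := (bag_exists z, bag_exists u).
have [[k xk] [l yl]] := (bag_exists x, bag_exists y).
(* If [x] or [y] lies beyond [u] as seen from [z], their common level is at most [2 L]. Otherwise
   both lie on the side of [z], and the bag of one is between those of [u] and the other. *)
have [far|near] := boolP (between j i k || between j i l).
  have : dist e u x <= L.*2.
    by case/orP: far => /dist_behind_farthest far; [|rewrite uxy];
      apply: far (farP _); eassumption.
  by have := dist_triangle u x y; rewrite (dist_sym x u); lia.
have [jkl|jlk] : between k j l \/ between l j k.
  by move: near; rewrite /between; lia.
  by have := dist_same_side jkl uj xk yl uxy; lia.
by have := dist_same_side jlk uj yl xk (esym uxy); rewrite dist_sym; lia.
Qed.

End PathDecomposition.

Lemma level_diam_farthest L z u : path_length e <= L ->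
  (forall x, dist e z x <= dist e z u) -> max_level_diam (4 * L) u.
Proof.
rewrite /path_length; case: ex_minnP => l /asboolP[B decB lenB] _ lL.
by apply: (@level_diam_farthest_bags B) => //; rewrite lenB.
Qed.

(** * Burning number against diameter *)

Lemma burning_numberP : exists2 s, burns e s & size s = burning_number e.
Proof.
rewrite /burning_number; case: ex_minnP => m /existsP[s bs] _.
by exists s; rewrite ?size_tuple.
Qed.

Lemma dist_burning_number x y : dist e x y < burning_number e ^ 2.
Proof. by have [s bs <-] := burning_numberP; apply: burns_dist. Qed.

Lemma diameter_burning_number : diameter e < burning_number e ^ 2.
Proof.
have [x _] : exists x, x \in T by apply/card_gt0P; case: e_conn.
have lt0 : 0 < burning_number e ^ 2.
  exact: leq_ltn_trans (leq0n _) (dist_burning_number x x).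
rewrite -(prednK lt0) ltnS; apply/bigmax_leqP => y _; apply/bigmax_leqP => z _.
by rewrite -ltnS prednK ?dist_burning_number.
Qed.

End Distance.

(** * Counted loops, their semantics and running time *)

Local Notation eval := Defs.eval.
Local Notation mem := Defs.mem.

(* [LFor x c] runs [c] with register [x] equal to 0, ..., n - 1, where n is the
   value of register 0. *)
Inductive loop : Type :=
  | LSet of nat & expr
  | LPut of nat & expr & expr
  | LSeq of loop & loop
  | LIf of expr & loop
  | LFor of nat & loop.

Fixpoint compile (c : loop) : cmd :=
  match c with
  | LSet x f => CSet x f
  | LPut a f g => CPut a f g
  | LSeq c1 c2 => CSeq (compile c1) (compile c2)
  | LIf f c => CIf f (compile c) CSkip
  | LFor x c =>
      CSeq (CSet x (ECst 0))
           (CWhile (ESub (EReg 0) (EReg x))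
                   (CSeq (compile c) (CSet x (EAdd (EReg x) (ECst 1)))))
  end.

(** A total semantics: the number of iterations is the parameter [n], which agrees with register 0
    as long as nothing is written there. *)
Fixpoint run (n : nat) (c : loop) (st : state) : state :=
  match c with
  | LSet x f => set_reg st x (eval st f)
  | LPut a f g => set_mem st a (eval st f) (eval st g)
  | LSeq c1 c2 => run n c2 (run n c1 st)
  | LIf f c => if eval st f != 0 then run n c st else st
  | LFor x c =>
      iteri n (fun k s => set_reg (run n c s) x k.+1) (set_reg st x 0)
  end.

(** A bound independent of the state. An iteration costs 9 beyond its body: 3 for the test, 4 for
    the increment, 2 for the constructors. Initialisation, sequencing and the last, failing test
    make up the 7. *)
Fixpoint time (n : nat) (c : loop) : nat :=
  match c with
  | LSet x f => (cost f).+1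
  | LPut a f g => (cost f + cost g).+1
  | LSeq c1 c2 => (time n c1 + time n c2).+1
  | LIf f c => (cost f + time n c).+2
  | LFor x c => n * (time n c + 9) + 7
  end.

Fixpoint reg_writes (c : loop) : seq nat :=
  match c with
  | LSet x f => [:: x]
  | LPut a f g => [::]
  | LSeq c1 c2 => reg_writes c1 ++ reg_writes c2
  | LIf f c => reg_writes c
  | LFor x c => x :: reg_writes c
  end.

Fixpoint mem_writes (c : loop) : seq nat :=
  match c with
  | LSet x f => [::]
  | LPut a f g => [:: a]
  | LSeq c1 c2 => mem_writes c1 ++ mem_writes c2
  | LIf f c => mem_writes c
  | LFor x c => mem_writes c
  end.

(** When a body spares its own counter, the compiled increment yields the value that [run]
    assigns. *)
Fixpoint counters_ok (c : loop) : bool :=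
  match c with
  | LSeq c1 c2 => counters_ok c1 && counters_ok c2
  | LIf f c => counters_ok c
  | LFor x c => (x \notin reg_writes c) && counters_ok c
  | _ => true
  end.

Definition unchanged (c : loop) (st st' : state) : Prop :=
  (forall x, x \notin reg_writes c -> regs st' x = regs st x) /\
  (forall a, a \notin mem_writes c -> mem st' a = mem st a).

Lemma iteri_ind (A : Type) (I : nat -> A -> Prop) (f : nat -> A -> A) n a :
  I 0 a -> (forall k b, k < n -> I k b -> I k.+1 (f k b)) -> I n (iteri n f a).
Proof.
move=> I0 IS; elim: n IS => //= n IHn IS; apply: (IS) => //.
by apply: IHn => k b kn; apply: IS; apply: ltnW.
Qed.

Lemma run_unchanged n c st : unchanged c st (run n c st).
Proof.
elim: c st => [x f|a f g|c1 IH1 c2 IH2|f c IHc|x c IHc] st; split=> y //=.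
- by rewrite inE => /negPf->.
- by rewrite inE => /negPf y_a; apply: funext => k; rewrite y_a.
- by rewrite mem_cat negb_or => /andP[y1 y2]; rewrite (IH2 _).1 // (IH1 _).1.
- by rewrite mem_cat negb_or => /andP[y1 y2]; rewrite (IH2 _).2 // (IH1 _).2.
- by case: ifP => // _; apply: (IHc _).1.
- by case: ifP => // _; apply: (IHc _).2.
- rewrite inE negb_or => /andP[/negPf y_x yc].
  apply: (@iteri_ind _ (fun _ s => regs s y = regs st y)) => [|k s _] /=;
    rewrite y_x //.
  by rewrite (IHc _).1.
move=> yc; apply: (@iteri_ind _ (fun _ s => mem s y = mem st y)) => //= k s _.
by rewrite (IHc _).2.
Qed.

Lemma run_seq n c1 c2 st : run n (LSeq c1 c2) st = run n c2 (run n c1 st).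
Proof. by []. Qed.

(** The loop-invariant rule. The counter value and the frame condition come for free, so an
    invariant mentions only what the body changes. *)
Lemma run_for_ind (I : nat -> state -> Prop) n x c st :
    I 0 (set_reg st x 0) ->
    (forall k s, k < n -> regs s x = k -> unchanged (LFor x c) st s -> I k s ->
       I k.+1 (set_reg (run n c s) x k.+1)) ->
  I n (run n (LFor x c) st).
Proof.
move=> I0 IS /=.
suff [] : [/\ I n (run n (LFor x c) st), regs (run n (LFor x c) st) x = n
           & unchanged (LFor x c) st (run n (LFor x c) st)] by [].
apply: (@iteri_ind _ (fun k s =>
  [/\ I k s, regs s x = k & unchanged (LFor x c) st s])).
  split; rewrite /= ?eqxx //; split=> //= y.
  by rewrite inE negb_or => /andP[/negPf->].
move=> k s kn [Ik sx [Us1 Us2]]; split; rewrite /= ?eqxx //; first exact: IS.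
split=> [y|a] /= ya; last by rewrite (run_unchanged n c s).2 // Us2.
move: (ya); rewrite inE negb_or => /andP[/negPf-> yc].
by rewrite (run_unchanged n c s).1 // Us1.
Qed.

Lemma exec_compile n c st :
    counters_ok c -> 0 \notin reg_writes c -> regs st 0 = n ->
  exists2 t, exec (compile c) st t (run n c st) & t <= time n c.
Proof.
elim: c st => [x f|a f g|c1 IH1 c2 IH2|f c IHc|x c IHc] st /=.
- by move=> _ _ _; exists (cost f).+1 => //; constructor.
- by move=> _ _ _; exists (cost f + cost g).+1 => //; constructor.
- case/andP=> ok1 ok2; rewrite mem_cat negb_or => /andP[w1 w2] st0.
  have [t1 e1 le1] := IH1 st ok1 w1 st0.
  have [|t2 e2 le2] := IH2 (run n c1 st) ok2 w2.
    by rewrite (run_unchanged n c1 st).1.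
  by exists (t1 + t2).+1; [apply: ExecSeq e1 e2 | lia].
- move=> okc wc st0; case: ifP => [f1|/negbFE/eqP f0].
    have [t et le_t] := IHc st okc wc st0.
    by exists (cost f + t).+1; [apply: ExecIfTrue | lia].
  by exists (cost f + 1).+1; [apply: ExecIfFalse => //; constructor | lia].
case/andP=> xc okc; rewrite inE negb_or eq_sym => /andP[/negPf x0 wc] st0.
set step := fun k s => set_reg (run n c s) x k.+1.
set S := fun k => iteri k step (set_reg st x 0).
have S_regs k : regs (S k) x = k /\ regs (S k) 0 = n.
  rewrite /S; elim: k => [|k [IHx IH0]] /=; rewrite eqxx eq_sym x0 //.
  by rewrite (run_unchanged n c _).1.
(* Here [k] counts the iterations still to run. *)
have loopP k : k <= n -> exists2 t,
    exec (CWhile (ESub (EReg 0) (EReg x))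
           (CSeq (compile c) (CSet x (EAdd (EReg x) (ECst 1)))))
         (S (n - k)) t (S n) & t <= k * (time n c + 9) + 4.
  elim: k => [|k IHk] kn.
    rewrite subn0; exists 4 => //.
    by apply: (@ExecWhileFalse (ESub (EReg 0) (EReg x)));
      rewrite /= (S_regs _).1 (S_regs _).2 subnn.
  have [t2 e2 le2] := IHk (ltnW kn).
  have [t1 e1 le1] := IHc (S (n - k.+1)) okc wc (S_regs _).2.
  exists (3 + (t1 + 4).+1 + t2).+1; last by rewrite mulSn; lia.
  apply: ExecWhileTrue e2.
    by rewrite /= (S_regs _).1 (S_regs _).2; lia.
  apply: ExecSeq e1 _.
  have -> : S (n - k) = set_reg (run n c (S (n - k.+1))) x
      (eval (run n c (S (n - k.+1))) (EAdd (EReg x) (ECst 1))).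
    rewrite -{1}(subnSK kn) /S /= -/(S _) /step; congr set_reg.
    by rewrite (run_unchanged n c _).1 // (S_regs _).1 addn1.
  exact: ExecSet.
have [t et le_t] := loopP n (leqnn n); rewrite subnn in et.
exists (2 + t).+1; last by lia.
by apply: ExecSeq et; apply: ExecSet.
Qed.

(** The base [n.+1] keeps all powers positive, so that bounds of different degrees combine; each
    loop raises the degree by one. *)
Lemma time_polynomial c : exists a k, forall n, time n c <= a * n.+1 ^ k.
Proof.
have one n k : 0 < n.+1 ^ k by rewrite expn_gt0.
elim: c => [x f|a f g|c1 [a1 [k1 IH1]] c2 [a2 [k2 IH2]]
           |f c [a [k IHc]]|x c [a [k IHc]]] /=.
- by exists (cost f).+1, 0 => n; rewrite muln1.
- by exists (cost f + cost g).+1, 0 => n; rewrite muln1.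
- exists (a1 + a2 + 1), (k1 + k2) => n; rewrite expnD.
  have := IH1 n; have := IH2 n; have := one n k1; have := one n k2.
  move: (n.+1 ^ k1) (n.+1 ^ k2) (time n c1) (time n c2) => p q t1 t2; nia.
- exists (cost f + a + 2), k => n.
  have := IHc n; have := one n k; move: (n.+1 ^ k) (time n c) => p t; nia.
exists (a + 16), k.+1 => n; rewrite expnS.
have := IHc n; have := one n k; move: (n.+1 ^ k) (time n c) => p t; nia.
Qed.

(** Passes to the powers of [n] in [polynomial_time]; the added 1 covers [n = 0]. *)
Lemma expnS_le n k : n.+1 ^ k <= 2 ^ k * n ^ k + 1.
Proof.
case: n => [|n]; first by rewrite exp1n addn1.
rewrite -expnMn; apply: leq_trans (leq_addr _ _).
by case: k => // k; rewrite leq_exp2r //; lia.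
Qed.


(** * Breadth-first search on the machine *)

Section Programs.
Variables (n : nat) (e : rel 'I_n).
Implicit Types (st : state) (i j u v : 'I_n).

Definition adjacency st :=
  regs st 0 = n /\ forall i j, mem st 0 (i * n + j) = e i j.

Lemma adjacency_unchanged c st st' : unchanged c st st' ->
  0 \notin reg_writes c -> 0 \notin mem_writes c ->
  adjacency st -> adjacency st'.
Proof. by move=> [Uregs Umem] r0 m0 [s0 s_e]; split; rewrite ?Uregs ?Umem. Qed.

(* Array [D] receives [n] minus the distance to the vertex in register [x]:
   under this encoding the initial zeros are valid bounds. *)
Definition bfs (x D : nat) : loop :=
  LSeq (LPut D (EReg x) (EReg 0))
       (LFor 1
          (LSeq (LSet 4 (ECst 0))
                (LFor 2
                   (LSeq (LFor 3
                            (LIf (EGet 0 (EAdd (EReg 4) (EReg 3)))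
                                 (LPut D (EReg 3)
                                    (EAdd (EGet D (EReg 3))
                                       (ESub (ESub (EGet D (EReg 2)) (ECst 1))
                                             (EGet D (EReg 3)))))))
                         (LSet 4 (EAdd (EReg 4) (EReg 0))))))).

(** The searched arrays hold [n] minus a distance, so a minimal entry marks a farthest vertex. *)
Definition argmin (D x : nat) : loop :=
  LSeq (LSet x (ECst 0))
       (LFor 1 (LIf (ESub (EGet D (EReg x)) (EGet D (EReg 1)))
                    (LSet x (EReg 1)))).

Lemma run_argmin D x st (st' := run n (argmin D x) st) : 0 < n -> x != 1 ->
  regs st' x < n /\ forall k, k < n -> mem st' D (regs st' x) <= mem st' D k.
Proof.
move=> n_gt0 x1; rewrite {}/st' run_seq.
apply: (run_for_ind (I := fun m s => regs s x < n /\
          forall k, k < m -> mem s D (regs s x) <= mem s D k)).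
  by rewrite /= (negPf x1) eqxx.
move=> m s mn s1 _ [xn xmin] /=; rewrite s1 (negPf x1).
case: ifP => [lt_m|/negbFE le_m] /=; rewrite ?(negPf x1) ?eqxx; split=> // k.
  rewrite ltnS leq_eqVlt => /predU1P[->|/xmin le_k] //; lia.
by rewrite ltnS leq_eqVlt => /predU1P[->|/xmin le_k] //; lia.
Qed.

Hypothesis e_conn : connected_graph e.

(** The invariant after [t] rounds and the first [p] matrix entries of the next: no distance is
    understated, distances up to [t] are exact, and scanned edges leaving vertices within [t] have
    been relaxed. Sums avoid truncated subtraction. *)
Let near (D : nat) (u : 'I_n) (t p : nat) (st : state) :=
  [/\ forall j, mem st D j + dist e u j <= n,
      forall j, dist e u j <= t -> n <= mem st D j + dist e u j
    & forall i j, i * n + j < p -> e i j -> dist e u i <= t ->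
        n <= mem st D j + (dist e u i).+1].

(** Each round relaxes all edges, in the manner of Bellman and Ford; [n] rounds suffice because
    distances are below [n]. *)
Lemma run_bfs x D st u (st' := run n (bfs x D) st) : D != 0 -> adjacency st ->
    (forall k, mem st D k = 0) -> regs st x = u ->
  forall j, mem st' D j = n - dist e u j.
Proof.
move=> D0 [st0 st_e] stD stx; rewrite {}/st' run_seq.
have dn j : dist e u j < n by have := dist_ltn e_conn u j; rewrite card_ord.
set st1 := run n (LPut _ _ _) st.
have st1_adj : adjacency st1.
  by split=> //= i j; rewrite eq_sym (negPf D0) /= st_e.
set st2 := run n (LFor 1 _) st1.
suff [le_n ge_n _] : near D u n 0 st2.
  by move=> j; have := le_n j; have := ge_n j (ltnW (dn j)); lia.
apply: (run_for_ind (I := fun t s => near D u t 0 s)) => [|t s tn s1].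
  split=> //= j; rewrite !eqxx /= stx stD.
    case: eqP => [/val_inj->|_]; first by rewrite distxx st0 addn0.
    exact: ltnW (dn j).
  rewrite leqn0 => /eqP uj; case: eqP => [|ju]; first by rewrite st0 leq_addr.
  have := dist_walk e_conn u j; rewrite uj walk0 => /eqP ujE.
  by rewrite ujE in ju.
move=> /adjacency_unchanged s_adj near_t.
have {}s_adj : adjacency s by apply: s_adj; rewrite //= mem_seq1 eq_sym.
rewrite run_seq; set s' := run n (LFor 2 _) _.
(* After a full scan, a vertex at distance [t.+1] has its value from its predecessor on a shortest
   walk. *)
suff [le_n ge_n edge] : near D u t (n * n) s'.
  split=> //= j.
  rewrite leq_eqVlt => /predU1P[uj|]; last exact: ge_n.
  have [i ui ij] := dist_last e_conn uj.
  have := edge i j _ ij; rewrite ui uj; apply=> //.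
  by have := ltn_ord i; have := ltn_ord j; nia.
(* Register 4 carries the row offset, built by addition since the machine cannot multiply. *)
suff [] : near D u t (n * n) s' /\ regs s' 4 = n * n by [].
apply: (run_for_ind (I := fun k s => near D u t (k * n) s /\ regs s 4 = k * n)).
  by split.
move=> i' r i'n r2 /adjacency_unchanged r_adj [near_r r4].
have {}r_adj : adjacency r by apply: r_adj; rewrite //= mem_seq1 eq_sym.
rewrite run_seq; set r' := run n (LFor 3 _) _.
suff [near_r' r'4] : near D u t (i' * n + n) r' /\ regs r' 4 = i' * n.
  have r'0 : regs r' 0 = n by rewrite (run_unchanged n _ r).1 // r_adj.1.
  by rewrite mulSn addnC; split; rewrite //= r'4 r'0.
apply: (run_for_ind (I := fun k s =>
          near D u t (i' * n + k) s /\ regs s 4 = i' * n)).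
  by rewrite addn0.
move=> j' q j'n q3 Uq [near_q q4].
have q2 : regs q 2 = i' by rewrite Uq.1.
have /adjacency_unchanged q_adj := Uq.
have {Uq}q_adj : adjacency q by apply: q_adj; rewrite //= mem_seq1 eq_sym.
set q' := run n _ q.
pose i := Ordinal i'n; pose j := Ordinal j'n.
have [regs_q' mem_q'_le]: regs q' = regs q /\ forall j, mem q D j <= mem q' D j.
  rewrite /q' /=; case: ifP => _; split=> //= v; rewrite eqxx.
  by case: eqP => [->|_] //=; lia.
case: near_q => le_n ge_n edge; split; last by rewrite /= regs_q'.
(* Adding the truncated difference [b - a] to [a] computes [maxn a b]. *)
have q'E v : mem q' D v =
    if (v == j) && e i j then maxn (mem q D j) (mem q D i - 1) else mem q D v.
  have := q_adj.2 i j; rewrite /q' /= q3 q4 q2 => ->.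
  rewrite eqb0 negbK; case: (e i j) => /=; last by rewrite andbF.
  rewrite eqxx andbT -val_eqE /=; case: eqP => //= _; lia.
split=> /= [v|v uv|v w].
- rewrite q'E; case: andP => [[/eqP-> ij]|_ //].
  have := dist_triangle e_conn i u j; have := dist_edge ij.
  have := dn j; have := le_n i; have := le_n j; lia.
- by apply: leq_trans (ge_n v uv) _; rewrite leq_add2r.
move=> vw_lt vw uv; have := mem_q'_le w.
have [/edge/(_ vw uv)|] := ltnP (v * n + w) (i' * n + j'); first lia.
move=> le_vw _.
(* The only newly scanned entry is the current one. *)
have vi : v = i.
  by apply: val_inj => /=; have := ltn_ord v; have := ltn_ord w; nia.
have wj : w = j by apply: val_inj => /=; move: vw_lt le_vw; rewrite vi /=; lia.
rewrite q'E wj eqxx -vi -wj vw /=; have := ge_n v uv; have := le_n v; lia.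
Qed.

(** * Computing the schedule *)

(* Arrays 2 and 3 hold the distances of the two sweeps, array 4 a vertex of
   each level, array 5 the center of each radius.  Registers 6 and 7 hold the
   starting vertex of the second sweep and a vertex at maximal distance from it,
   registers 8, 9 and 10 that distance, a number [r] of radii, and [r ^ 2]. *)
Definition level_vertices : loop := LFor 1 (LPut 4 (EGet 3 (EReg 1)) (EReg 1)).

(** With [M] in register 8, [level - (level - M)] is [minn level M]; subtracting it from [n] gives
    the index into array 4. Adding [2 r + 1] keeps register 10 at [r ^ 2]. *)
Definition centers : loop :=
  let level := EAdd (EReg 10) (EReg 9) in
  LFor 1
    (LIf (ESub (EAdd (EReg 8) (ECst 1)) (EReg 10))
       (LSeq (LPut 5 (EReg 9)
                (EGet 4 (ESub (EReg 0) (ESub level (ESub level (EReg 8))))))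
       (LSeq (LSet 10 (EAdd (EReg 10) (EAdd (EReg 9) (EAdd (EReg 9) (ECst 1)))))
             (LSet 9 (EAdd (EReg 9) (ECst 1)))))).

(** Largest radius first. From index [r - 1] on, truncation repeats the center of radius 0 as filler
    for the extra rounds. *)
Definition activators : loop :=
  LFor 1 (LPut 1 (EReg 1) (EGet 5 (ESub (ESub (EReg 9) (ECst 1)) (EReg 1)))).

Definition sweeps : loop :=
  LSeq (bfs 5 2) (LSeq (argmin 2 6)
  (LSeq (bfs 6 3) (LSeq (argmin 3 7)
        (LSet 8 (ESub (EReg 0) (EGet 3 (EReg 7))))))).

Definition schedule : loop :=
  LSeq sweeps (LSeq level_vertices
  (LSeq (LSeq (LSet 9 (ECst 0)) (LSet 10 (ECst 0))) (LSeq centers activators))).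

(** Array 4 inverts array 3 up to the choice of a vertex in each level. A later vertex of a level
    may overwrite an earlier one without harming the composite identity. *)
Lemma run_level_vertices st (st' := run n level_vertices st) :
    0 < n -> (forall k, mem st 4 k = 0) ->
  (forall k, mem st' 4 k < n) /\
  (forall k, k < n -> mem st 3 (mem st' 4 (mem st 3 k)) = mem st 3 k).
Proof.
move=> n_gt0 st4.
apply: (run_for_ind (I := fun m s => (forall k, mem s 4 k < n) /\
  forall k, k < m -> mem st 3 (mem s 4 (mem st 3 k)) = mem st 3 k)).
  by split=> //= k; rewrite st4.
move=> m s mn s1 [_ Um] [lt_n s4] /=.
rewrite s1 Um //=; split=> k; first by case: ifP.
rewrite ltnS leq_eqVlt => /predU1P[->|km]; first by rewrite eqxx.
by case: eqP => [->|_] //; apply: s4.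
Qed.

(** Until [r ^ 2] exceeds register 8, each iteration increments [r]; [n] iterations suffice as
    register 8 is below [n]. *)
Lemma run_centers st (st' := run n centers st) (r := regs st' 9) :
    regs st 0 = n -> regs st 8 < n -> regs st 9 = 0 -> regs st 10 = 0 ->
    (forall k, mem st 5 k < n) -> (forall k, mem st 4 k < n) ->
  [/\ forall k, mem st' 5 k < n, regs st 8 < r ^ 2, r <= n
    & forall rho, rho < r -> rho ^ 2 <= regs st 8 /\
        mem st' 5 rho = mem st 4 (n - minn (rho ^ 2 + rho) (regs st 8))].
Proof.
move=> st0 st8 st9 st10 st5 st4; rewrite {}/r.
have [] : [/\ forall k, mem st' 5 k < n, regs st' 9 <= n
    & forall rho, rho < regs st' 9 -> rho ^ 2 <= regs st 8 /\
        mem st' 5 rho = mem st 4 (n - minn (rho ^ 2 + rho) (regs st 8))] /\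
    regs st' 10 = regs st' 9 ^ 2 /\
    ((regs st 8 < regs st' 9 ^ 2) || (regs st' 9 == n)); last first.
  move=> [? ? ?] [_ /orP r_or]; split=> //.
  by case: r_or => // /eqP->; nia.
apply: (run_for_ind (I := fun m s =>
  [/\ forall k, mem s 5 k < n, regs s 9 <= m
    & forall rho, rho < regs s 9 -> rho ^ 2 <= regs st 8 /\
        mem s 5 rho = mem st 4 (n - minn (rho ^ 2 + rho) (regs st 8))] /\
    regs s 10 = regs s 9 ^ 2 /\
    ((regs st 8 < regs s 9 ^ 2) || (regs s 9 == m)))).
  by rewrite /= st9 st10.
move=> m s mn s1 [Ur Um] [[s5 s9m s5E] [s10 s9]] /=.
rewrite s10 (Ur 8) // (Ur 0) // st0.
case: ifP => [lt_r|/negbFE/eqP le_r] /=; last first.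
  split; [split=> //; lia | split=> //; apply/orP; left; lia].
rewrite Um //=; split; last first.
  by split; lia.
split=> [k||rho]; [by case: ifP | lia | ].
rewrite addn1 ltnS leq_eqVlt => /predU1P[->|lt_rho].
  rewrite eqxx; split; first by lia.
  by congr (mem st 4 (n - _)); lia.
by rewrite ltn_eqF //; apply: s5E.
Qed.

Lemma run_activators st (st' := run n activators st) :
    (forall k, mem st 1 k = 0) ->
  forall k, mem st' 1 k = if k < n then mem st 5 (regs st 9 - 1 - k) else 0.
Proof.
move=> st1.
apply: (run_for_ind (I := fun m s => forall k,
  mem s 1 k = if k < m then mem st 5 (regs st 9 - 1 - k) else 0)) => //=.
move=> m s mn s1 [Ur Um] s_out k; rewrite s1 Um //= Ur //= s_out ltnS.
by case: ltngtP => // ->.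
Qed.

Lemma adjacency_input : adjacency (graph_input e).
Proof.
split=> //= i j; congr nat_of_bool.
apply/existsP/idP => [[i' /existsP[j' /andP[/eqP ijE e_ij]]]|e_ij]; last first.
  by exists i; apply/existsP; exists j; rewrite eqxx.
have n_gt0 : 0 < n by apply: leq_trans (ltn_ord i).
have ii' : i = i'.
  apply: val_inj => /=; move/(congr1 (divn^~ n)): ijE => /=.
  by rewrite !divnMDl // !divn_small // !addn0.
have jj' : j = j'.
  by apply: val_inj => /=; move/eqP: ijE; rewrite ii' eqn_add2l => /eqP.
by rewrite ii' jj'.
Qed.

Lemma run_sweeps (st := run n sweeps (graph_input e)) : exists z u,
  [/\ forall x, dist e z x <= dist e z u,
      forall j, mem st 3 j = n - dist e u j
    & regs st 8 = \max_x dist e u x].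
Proof.
have n_gt0 : 0 < n by case: e_conn; rewrite card_ord.
have dn x y : dist e x y < n by have := dist_ltn e_conn x y; rewrite card_ord.
rewrite {}/st /sweeps; set st0 := graph_input e.
rewrite run_seq; set st1 := run n (bfs 5 2) st0.
rewrite run_seq; set st2 := run n (argmin 2 6) st1.
rewrite run_seq; set st3 := run n (bfs 6 3) st2.
rewrite run_seq; set st4 := run n (argmin 3 7) st3.
have U1 : unchanged (bfs 5 2) st0 st1 := run_unchanged _ _ _.
have U2 : unchanged (argmin 2 6) st1 st2 := run_unchanged _ _ _.
have U3 : unchanged (bfs 6 3) st2 st3 := run_unchanged _ _ _.
have U4 : unchanged (argmin 3 7) st3 st4 := run_unchanged _ _ _.
have A1 : adjacency st1 by apply: adjacency_unchanged U1 _ _ adjacency_input.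
have A2 : adjacency st2 by apply: adjacency_unchanged U2 _ _ A1.
have A3 : adjacency st3 by apply: adjacency_unchanged U3 _ _ A2.
(* Register 5 is never written, so the first search starts at vertex 0. *)
pose z := Ordinal n_gt0.
have st1_2 : forall j, mem st1 2 j = n - dist e z j.
  by apply: run_bfs => //; apply: adjacency_input.
have [un umin] : regs st2 6 < n /\
    forall k, k < n -> mem st1 2 (regs st2 6) <= mem st1 2 k.
  by rewrite -(U2.2 2) //; apply: run_argmin.
pose u := Ordinal un.
have st3_3 : forall j, mem st3 3 j = n - dist e u j.
  by apply: run_bfs => // k; rewrite U2.2 // U1.2.
have [wn wmin] : regs st4 7 < n /\
    forall k, k < n -> mem st3 3 (regs st4 7) <= mem st3 3 k.
  by rewrite -(U4.2 3) //; apply: run_argmin.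
pose w := Ordinal wn.
exists z, u; split=> [x|j|].
- have := umin x (ltn_ord x); rewrite st1_2 -[regs st2 6]/(val u) st1_2.
  by have := dn z x; have := dn z u; lia.
- by rewrite /= U4.2 // st3_3.
rewrite /= U4.2 // (U4.1 0) // A3.1 -[regs st4 7]/(val w) st3_3.
rewrite subKn; last exact: ltnW.
apply/eqP; rewrite eqn_leq (leq_bigmax w) /=; apply/bigmax_leqP => x _.
have := wmin x (ltn_ord x); rewrite st3_3 -[regs st4 7]/(val w) st3_3.
by have := dn u x; have := dn u w; lia.
Qed.

(** [L] enters only as a constant added to the number of radii. *)
Definition output_schedule (L : nat) : cmd :=
  CSeq (compile schedule) (CSet 0 (EAdd (EReg 9) (ECst (4 * L)))).

Hypothesis e_sym : symmetric e.

(** The program chooses [u], so the level bound is assumed only once [u] is known to be farthest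
    from [z], the property that implies the bound for small path-length. *)
Lemma run_schedule K (st := run n schedule (graph_input e)) : exists z u,
    (forall x, dist e z x <= dist e z u) /\
    (max_level_diam e K u -> exists s,
      [/\ mkseq (mem st 1) (regs st 9 + K) = [seq val v | v <- s],
          burns e s & size s <= burning_number e + K]).
Proof.
have n_gt0 : 0 < n by case: e_conn; rewrite card_ord.
have dn x y : dist e x y < n by have := dist_ltn e_conn x y; rewrite card_ord.
have [z [u [zu st1_3 st1_8]]] := run_sweeps.
exists z, u; split=> // diamK; set M := \max_x _ in st1_8.
rewrite {}/st /schedule; set st0 := graph_input e.
rewrite run_seq -/st0 in st1_3 st1_8 *; set st1 := run n sweeps st0.
rewrite run_seq; set st2 := run n level_vertices st1.
rewrite run_seq; set st3 := run n (LSeq (LSet 9 _) _) st2.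
rewrite run_seq; set st4 := run n centers st3.
set st5 := run n activators st4.
have U1 : unchanged sweeps st0 st1 := run_unchanged _ _ _.
have U2 : unchanged level_vertices st1 st2 := run_unchanged _ _ _.
have U4 : unchanged centers st3 st4 := run_unchanged _ _ _.
have U5 : unchanged activators st4 st5 := run_unchanged _ _ _.
have [|st2_4 st2_4E] := @run_level_vertices st1 n_gt0.
  by move=> k; rewrite U1.2.
have M_max x : dist e u x <= M by apply: leq_bigmax.
have [y yM] : exists y, M = dist e u y.
  by have [y yM] := eq_bigmax (dist e u) e_conn.1; exists y.
have st3_8 : regs st3 8 = M by rewrite /= U2.1.
(* Level [l] is nonempty: a shortest walk from [u] to the farthest vertex [y] passes through it. *)
have level_vertex l x0 : l <= M -> dist e u (insubd x0 (mem st2 4 (n - l))) = l.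
  move=> lM; move: (lM); rewrite yM => /(dist_split e_conn)[x ux _].
  set a := insubd _ _; have aE : mem st2 4 (n - l) = a.
    by rewrite val_insubd st2_4.
  have := st2_4E x (ltn_ord x); rewrite st1_3 ux aE st1_3.
  by have := dn u a; have := dn u y; lia.
have [|||||| st4_5 Mr rn st4_5E] := @run_centers st3 => //.
- by rewrite /= U2.1 // U1.1.
- by rewrite st3_8 yM.
- by move=> k; rewrite /= U2.2 // U1.2.
rewrite -/st4 st3_8 in st4_5 Mr rn st4_5E; set r := regs st4 9 in Mr rn st4_5E.
have st5_1 : forall k, mem st5 1 k = if k < n then mem st4 5 (r - 1 - k) else 0.
  by apply: run_activators => k; rewrite U4.2 //= U2.2 // U1.2.
have st5_lt k : mem st5 1 k < n by rewrite st5_1; case: ifP.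
(* All cells are below [n], so the default [z] is never taken. *)
pose s := [seq insubd z (mem st5 1 k) | k <- iota 0 (r + K)].
exists s; rewrite (U5.1 9) // -/r; split.
- by rewrite -map_comp; apply: eq_map => k /=; rewrite val_insubd st5_lt.
- apply: (@burns_levels _ _ e_conn e_sym K u r) => //.
  + by move=> x; apply: leq_ltn_trans (M_max x) Mr.
  + by rewrite size_map size_iota.
  move=> rho x0 rho_r _; rewrite -/M (nth_map 0) ?size_iota ?nth_iota; try lia.
  rewrite add0n st5_1 ifT; last lia.
  rewrite (_ : r - 1 - (r - rho.+1) = rho); last lia.
  by rewrite (st4_5E _ rho_r).2 level_vertex ?geq_minr.
rewrite size_map size_iota leq_add2r.
(* The square of the largest radius is at most [M], which is below the square of the burning
   number. *)
case: r Mr rn st4_5E {st5_1 s} => // r _ _ /(_ r (leqnn _))[rM _].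
rewrite -ltn_sqr; apply: leq_ltn_trans rM _.
by rewrite yM; apply: dist_burning_number.
Qed.

End Programs.

(** * Time bound and guarantee of the program *)

Lemma output_schedule_polynomial L : polynomial_time (output_schedule L).
Proof.
have [a [k time_le]] := time_polynomial schedule.
(* The first two terms come from [expnS_le]; the 5 pays for the final assignment and its
   sequencing. *)
exists (a * 2 ^ k + a + 5), k => n e _.
have [//|//|//|t ex_t le_t] := @exec_compile n schedule (graph_input e).
exists (t + 4).+1; eexists.
split; first by apply: ExecSeq ex_t _; apply: ExecSet.
have := leq_trans le_t (time_le n); have := expnS_le n k.
by move: (n.+1 ^ k) (n ^ k) (2 ^ k) => p q c; nia.
Qed.

Lemma output_schedule_burns L n (e : rel 'I_n) :
    symmetric e -> connected_graph e -> path_length e <= L ->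
  exists s, [/\ outputs (output_schedule L) e s, burns e s
               & size s <= burning_number e + 4 * L].
Proof.
move=> e_sym e_conn eL.
have [z [u [zu /(_ (level_diam_farthest e_conn e_sym eL zu))]]] :=
  run_schedule e_conn e_sym (4 * L).
move=> [s [out_s burns_s size_s]]; exists s; split=> //.
have [//|//|//|t ex_t _] := @exec_compile n schedule (graph_input e).
exists (t + 4).+1; eexists.
by split; [apply: ExecSeq ex_t _; apply: ExecSet | exact: out_s].
Qed.

(** * The approximation factor *)

Import Order.TTheory GRing.Theory Num.Theory.
Import numFieldNormedType.Exports.
Local Open Scope classical_set_scope.
Local Open Scope ring_scope.

Theorem corollary5 (R : realType) (L : nat) :
  exists P : cmd, polynomial_time P /\
  exists eps : nat -> R,
    [/\ forall d, 0 <= eps d,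
        eps @ \oo --> (0 : R)
      & forall (n : nat) (e : rel 'I_n),
          sgraph e -> connected_graph e -> (path_length e <= L)%N ->
          exists s : seq 'I_n,
            [/\ outputs P e s,
                burns e s
              & (size s)%:R <=
                  (1 + eps (diameter e)) * (burning_number e)%:R]].
Proof.
exists (output_schedule L); split; first exact: output_schedule_polynomial.
(* Since [d + 1 <= b ^ 2] for the burning number [b], this value times [b] is at least the excess
   [4 L]. *)
exists (fun d => (4 * L)%:R * Num.sqrt (d.+1%:R^-1)); split.
- by move=> d; rewrite mulr_ge0 ?ler0n ?sqrtr_ge0.
- rewrite -[X in _ --> X](mulr0 (4 * L)%:R) -sqrtr0.
  apply: cvgMr; apply: continuous_cvg; first exact: sqrt_continuous.
  exact: cvg_harmonic.
move=> n e [e_sym _] e_conn eL.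
have [s [out_s burns_s size_s]] := output_schedule_burns e_sym e_conn eL.
exists s; split=> //; set b := burning_number e in size_s *.
have d_b : ((diameter e).+1 <= b ^ 2)%N by apply: diameter_burning_number.
have b_gt0 : (0 : R) < b%:R by rewrite ltr0n; move: d_b; case: b {size_s}.
apply: (@le_trans _ _ ((b + 4 * L)%N%:R)); first by rewrite ler_nat.
rewrite natrD mulrDl mul1r lerD2l -mulrA ler_peMr ?ler0n //.
(* Writing [1 / b] as the square root of its square reduces the claim to [d + 1 <= b ^ 2]. *)
rewrite -ler_pdivrMr // mul1r -[leLHS]ger0_norm ?invr_ge0 ?ler0n //.
rewrite -sqrtr_sqr ler_wsqrtr // exprVn lef_pV2 ?posrE ?exprn_gt0 //.
by rewrite -natrX ler_nat.
Qed.
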